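(* Let $q=2^h$ with $h\geq 1$ odd. Let $s$ be an integer with $1\leq s\leq 5$ and $\gcd(s,6)=1$, and let $\sigma:\mathbb{F}_{q^6}\to\mathbb{F}_{q^6}$, $x\mapsto x^{q^s}$. Then the $\mathbb{F}_q$-subspace of $\mathbb{F}_{q^6}^4$ \[U_s:=\{(x,\,y,\,x^{\sigma^2}+y^{\sigma},\,x^{\sigma}+y^{\sigma^3}) : x,y\in\mathbb{F}_{q^6},\ \mathrm{Tr}_{q^6/q^2}(x)=\mathrm{Tr}_{q^6/q^2}(y)=0\}\] is a maximum $2$-scattered subspace of $\mathbb{F}_{q^6}^4$.
   Context: $\mathrm{Tr}_{q^6/q^2}(x)=x+x^{q^2}+x^{q^4}$ is the trace map of $\mathbb{F}_{q^6}$ over $\mathbb{F}_{q^2}$. Let $V$ be an $r$-dimensional $\mathbb{F}_{q^n}$-vector space. An $\mathbb{F}_q$-subspace $U$ of $V$ is called $h$-scattered ($0<h\leq r-1$) if $\langle U\rangle_{\mathbb{F}_{q^n}}=V$ and every $h$-dimensional $\mathbb{F}_{q^n}$-subspace of $V$ meets $U$ in an $\mathbb{F}_q$-subspace of dimension at most $h$. If $U$ is $h$-scattered and does not define a subgeometry, then $\dim_{\mathbb{F}_q}U\leq rn/(h+1)$; an $h$-scattered subspace of the highest possible dimension (here $rn/(h+1)=8$ for $r=4$, $n=6$, $h=2$) is called maximum $h$-scattered. *)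

(* Defs.v *)
From HB Require Import structures.
From mathcomp Require Import all_boot all_order all_algebra all_fingroup.
From mathcomp Require Import all_solvable all_field.

Set Implicit Arguments.
Unset Strict Implicit.
Unset Printing Implicit Defensive.

Import GRing.Theory.
Local Open Scope ring_scope.

Section RestrictionOfScalars.

Variables (F : fieldType) (L : fieldExtType F) (V : vectType L).

(* V with its scalars restricted from L to F. The carrier is convertible to V;
   the name only selects the F-linear structure. *)
Definition resScal : Type := V.

HB.instance Definition _ := GRing.Zmodule.on resScal.

Definition resScal_scale (a : F) (u : resScal) : resScal := (a%:A : L) *: (u : V).

Fact resScal_scaleA a b u :
  resScal_scale a (resScal_scale b u) = resScal_scale (a * b) u.
Proof. by rewrite /resScal_scale scalerA -scalerAl mul1r scalerA. Qed.

Fact resScal_scale1 u : resScal_scale 1 u = u.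
Proof. by rewrite /resScal_scale !scale1r. Qed.

Fact resScal_scaleDr a u v :
  resScal_scale a (u + v) = resScal_scale a u + resScal_scale a v.
Proof. exact: scalerDr. Qed.

Fact resScal_scaleDl v a b :
  resScal_scale (a + b) v = resScal_scale a v + resScal_scale b v.
Proof. by rewrite /resScal_scale scalerDl scalerDl. Qed.

HB.instance Definition _ := GRing.Zmodule_isLmodule.Build F resScal
  resScal_scaleA resScal_scale1 resScal_scaleDr resScal_scaleDl.

Lemma resScal_scaleE a (u : V) : a *: (u : resScal) = (a%:A : L) *: u.
Proof. by []. Qed.

Let n := \dim {:L}.
Let bL : n.-tuple L := vbasis {:L}.
Let coordL (x : L) := (coord_vbasis (memvf x)).

Fact resScal_vectMixin : Lmodule_hasFinDim F resScal.
Proof.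
pose bV := vbasis {:V}; set m := \dim {:V} in bV.
pose v2r (x : resScal) := mxvec (\matrix_(i, j) coord bL j (coord bV i (x : V))).
have v2r_lin: linear v2r.
  move=> a x y; rewrite -linearP; congr mxvec; apply/matrixP=> i j.
  by rewrite !mxE linearP /= mulr_algl linearP.
pose r2v r : resScal := \sum_(i < m) (\sum_(j < n) vec_mx r i j *: bL`_j) *: bV`_i.
have v2rK: cancel v2r r2v.
  move=> x; transitivity (\sum_(i < m) coord bV i x *: bV`_i); last first.
    by rewrite -coord_vbasis ?memvf.
  apply: eq_bigr => i _; rewrite mxvecK; congr (_ *: _ : V).
  by rewrite (coordL (coord bV i x)); apply: eq_bigr => j _; rewrite mxE.
exists (m * n)%N, v2r => //; exists r2v => // r.
apply: (canLR vec_mxK); apply/matrixP=> i j; rewrite mxE.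
by rewrite !coord_sum_free ?(basis_free (vbasisP _)).
Qed.

HB.instance Definition _ := resScal_vectMixin.

Let FZEZ a x v : a *: ((x *: v : V) : resScal) = (a *: x) *: v.
Proof. by rewrite [a *: _]scalerA -scalerAl mul1r. Qed.

(* The L-subspace W as an F-subspace; see mem_resVspace. *)
Definition resVspace (W : {vspace V}) : {vspace resScal} :=
  let b : seq resScal :=
    [seq tnth bL ij.2 *: tnth (vbasis W) ij.1 | ij : 'I_(\dim W) * 'I_n] in
  <<b>>%VS.

Lemma mem_resVspace (W : {vspace V}) (v : V) :
  ((v : resScal) \in resVspace W) = (v \in W).
Proof.
apply/idP/idP=> [/coord_span->|/coord_vbasis->]; last first.
  apply: (@memv_suml F resScal) => i _; rewrite (coordL (coord _ i v)) scaler_suml -/n.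
  apply: (@memv_suml F resScal) => j _; rewrite -/bL -FZEZ memvZ ?memv_span // -!tnth_nth.
  by apply/imageP; exists (i, j).
apply: (@memv_suml L V) => k _; rewrite nth_image; case: (enum_val k) => i j /=.
by rewrite FZEZ memvZ ?vbasis_mem ?mem_tnth.
Qed.

(* The L-span of the F-subspace U; see lspanP. *)
Definition lspan (U : {vspace resScal}) : {vspace V} := <<(vbasis U : seq V)>>%VS.

Lemma lspanP (U : {vspace resScal}) (W : {vspace V}) :
  reflect (forall u : V, (u : resScal) \in U -> u \in W) (lspan U <= W)%VS.
Proof.
apply: (iffP span_subvP) => sUW u Uu; last by apply/sUW/vbasis_mem.
rewrite (coord_vbasis Uu); apply: (@memv_suml L V) => i _.
by rewrite resScal_scaleE memvZ // sUW // mem_nth ?size_tuple.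
Qed.

Definition scattered (h : nat) (U : {vspace resScal}) : Prop :=
  [/\ (0 < h < \dim {:V})%N,
      lspan U = fullv
    & forall W : {vspace V}, \dim W = h ->
        (\dim (U :&: resVspace W) <= h)%N].

Definition max_scattered (h : nat) (U : {vspace resScal}) : Prop :=
  scattered h U /\
  forall U' : {vspace resScal}, scattered h U' -> (\dim U' <= \dim U)%N.

End RestrictionOfScalars.

Section TheSubspace.

Variables (F : finFieldType) (L : fieldExtType F).

Local Notation q := #|F|.

Definition frob (s : nat) (x : L) : L := x ^+ (q ^ s).

(* The trace of F_(q^6) over F_(q^2) when L has degree 6 over F. *)
Definition Tr62 (x : L) : L := x + x ^+ (q ^ 2) + x ^+ (q ^ 4).

Fact frob_linear s : linear (frob s).
Proof.
move=> a x y; rewrite /frob.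
have [p p_pr pF] := finPcharP F.
have qL : [pchar L].-nat (q ^ s)%N.
  rewrite pnatX; apply/orP; left.
  have: p.-nat q.
    by have /abelem_pgroup := fin_ring_pchar_abelem pF; rewrite /pgroup cardsT.
  apply: sub_in_pnat => r _ /eqnP->.
  by rewrite pchar_lalg.
rewrite exprDn_pchar // exprZn; congr (_ *: _ + _).
by elim: s {qL} => // s IHs; rewrite expnSr exprM IHs expf_card.
Qed.
HB.instance Definition _ s := GRing.isLinear.Build F L L _ (frob s) (frob_linear s).

Fact Tr62_linear : linear Tr62.
Proof.
move=> a x y; rewrite /Tr62 -!/(frob _ _) !linearP /= !scalerDr.
by rewrite (addrACA (a *: x)) (addrACA (a *: x + _)).
Qed.
HB.instance Definition _ := GRing.isLinear.Build F L L _ Tr62 Tr62_linear.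

Definition Uvec (s : nat) (x y : L) : 'rV[L]_4 :=
  let sigma := frob s in
  \row_(i < 4) [:: x; y; iter 2 sigma x + sigma y; sigma x + iter 3 sigma y]`_i.

Definition Uvec2 (s : nat) (xy : L * L) : resScal 'rV[L]_4 := Uvec s xy.1 xy.2.

Fact Uvec2_linear s : linear (Uvec2 s).
Proof.
move=> a x y; apply/rowP=> i; rewrite /Uvec2 resScal_scaleE !mxE mulr_algl.
case: i => [[|[|[|[|i]]]] //= _]; rewrite !linearP /= ?scalerDr //.
  by rewrite addrACA.
by rewrite addrACA.
Qed.
HB.instance Definition _ s :=
  GRing.isLinear.Build F (L * L)%type (resScal 'rV[L]_4) _ (Uvec2 s) (Uvec2_linear s).

(* The set of the Uvec s x y with x and y of trace 0, as an F-subspace; see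
   mem_Us. *)
Definition Us (s : nat) : {vspace resScal 'rV[L]_4} :=
  (linfun (Uvec2 s) @:
     (lker (linfun (Tr62 \o fst)) :&: lker (linfun (Tr62 \o snd))))%VS.

Lemma mem_Us s (v : 'rV[L]_4) :
  (v : resScal 'rV[L]_4) \in Us s <->
  exists x y : L, [/\ Tr62 x = 0, Tr62 y = 0 & v = Uvec s x y].
Proof.
split=> [/memv_imgP[[x y]]|[x [y [Tx Ty ->]]]].
  rewrite memv_cap !memv_ker !lfunE /= => /andP[/eqP Tx /eqP Ty] ->.
  by exists x, y.
have -> : Uvec s x y = linfun (Uvec2 s) (x, y) by rewrite lfunE.
by apply: memv_img; rewrite memv_cap !memv_ker !lfunE /= Tx Ty eqxx.
Qed.

End TheSubspace.

(* Main.v *)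
Require Import Defs.
From Stdlib Require Import Ring.
From HB Require Import structures.
From mathcomp Require Import all_boot all_algebra all_field.

(* Let s denote the automorphism x |-> x^(q^s) of L, K the fixed field of s^2, and w in K a
   primitive cube root of unity. As h is odd, s w = w^2, and the kernel of the
   trace is theta K + s(theta) K for an eigenvector theta of s^2. An L-linear
   relation lam between three vectors of U that are linearly independent over F
   becomes, in these coordinates, a system dot lam (s p_(i+1)) = t dot lam p_i
   with p_0, ..., p_3 in K^3, p_4 = p_0 + w p_2 and t = theta / s(theta). The
   K-relations between the four elements dot lam p_i of L, which has dimension 3
   over K, then form a nonzero subspace of K^4 stable under the semilinear map
   psi with psi^4 = 1 + w psi^2. There is no such proper subspace, because
   X^2 + w X + 1 divides X^5 - 1 and K contains no primitive fifth root of unity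
   (h is odd again). So lam = 0, which is the 2-scattered property.

   For the bound, if l1, l2, l3 in L are independent over F and U meets every
   L-plane in dimension at most 2, then the sum l1 U + l2 U + l3 U is direct;
   hence 3 dim_F U <= 6 dim_L <U>. This also shows that U spans the whole space,
   since dim_F U >= 8. *)

Set Implicit Arguments.
Unset Strict Implicit.
Unset Printing Implicit Defensive.

Import GRing.Theory.
Local Open Scope ring_scope.

(** * The standard bilinear form on row vectors *)

Section DotProduct.

Variables (R : comNzRingType) (n : nat).

Definition dot (a b : 'rV[R]_n) : R := \sum_i a 0 i * b 0 i.

Lemma dotC a b : dot a b = dot b a.
Proof. by apply: eq_bigr => i _; rewrite mulrC. Qed.

Lemma dotDr a b c : dot a (b + c) = dot a b + dot a c.
Proof. by rewrite -big_split; apply: eq_bigr => i _; rewrite mxE mulrDr. Qed.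

Lemma dotZr x a b : dot a (x *: b) = x * dot a b.
Proof. by rewrite mulr_sumr; apply: eq_bigr => i _; rewrite mxE mulrCA. Qed.

Lemma dotDl a b c : dot (a + b) c = dot a c + dot b c.
Proof. by rewrite dotC dotDr !(dotC c). Qed.

Lemma dotZl x a b : dot (x *: a) b = x * dot a b.
Proof. by rewrite dotC dotZr dotC. Qed.

Lemma dot0l a : dot 0 a = 0.
Proof. by rewrite -[X in dot X](scale0r 0) dotZl mul0r. Qed.

Lemma dot0r a : dot a 0 = 0.
Proof. by rewrite dotC dot0l. Qed.

Definition dotE := (dotDr, dotZr, dotDl, dotZl, dot0l, dot0r).

Lemma dot_map (s : {rmorphism R -> R}) a b :
  dot (map_mx s a) (map_mx s b) = s (dot a b).
Proof. by rewrite rmorph_sum; apply: eq_bigr => i _; rewrite !mxE rmorphM. Qed.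

End DotProduct.

(** * The automorphism [s] in characteristic 2 and the fixed field [K] of [s \o s] *)

Section SigmaAlgebra.

Variables (L : fieldType) (s : {rmorphism L -> L}).
Hypotheses (L2 : 2 \in [pchar L]).

(** Named copies of the operations, with the identity as opposite, let [ring] work with coefficients
    in the two-element field [bool]. *)
Let zero2 : L := 0.
Let one2 : L := 1.
Let add2 (x y : L) : L := x + y.
Let mul2 (x y : L) : L := x * y.
Let opp2 (x : L) : L := x.
Let of_bool (b : bool) : L := if b then one2 else zero2.

Let L_ring : ring_theory zero2 one2 add2 mul2 add2 opp2 eq.
Proof.
split=> //; rewrite /zero2 /one2 /add2 /mul2 /opp2; first exact: add0r.
- exact: addrC.
- exact: addrA.
- exact: mul1r.
- exact: mulrC.
- exact: mulrA.
- exact: mulrDl.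
- exact: addrr_pchar2.
Qed.

Let L_morph : ring_morph zero2 one2 add2 mul2 add2 opp2 eq
  false true xorb andb xorb id eqb of_bool.
Proof.
split=> //; rewrite /of_bool /zero2 /one2 /add2 /mul2 /opp2.
- by case=> [] []; rewrite /= ?addr0 ?add0r // addrr_pchar2.
- by case=> [] []; rewrite /= ?addr0 ?add0r // addrr_pchar2.
- by case=> [] []; rewrite /= ?mulr0 ?mul0r ?mulr1.
- by case=> [] [].
Qed.

Ltac of_bool_cst t :=
  match t with
  | zero2 => constr:(false)
  | one2 => constr:(true)
  | _ => constr:(InitialRing.NotConstant)
  end.

Add Ring char2 : L_ring (morphism L_morph, constants [of_bool_cst]).

Let add2E (a b : L) : a + b = add2 a b. Proof. by []. Qed.
Let mul2E (a b : L) : a * b = mul2 a b. Proof. by []. Qed.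
Let zero2E : 0 = zero2. Proof. by []. Qed.
Let one2E : 1 = one2. Proof. by []. Qed.

Let eq2 (a b : L) : a + b = 0 -> a = b.
Proof. by move/eqP; rewrite addr_eq0 (oppr_pchar2 L2) => /eqP. Qed.

Ltac to_char2 :=
  apply: eq2;
  rewrite ?(oppr_pchar2 L2) ?expr2 ?mul2E ?add2E ?zero2E ?one2E;
  lazymatch goal with
  | |- @eq _ ?a ?b => change (@eq (GRing.Field.sort L) a b)
  end.

(** [X^3 + 1] factors as [(X + 1) (X^2 + X + 1)], and the first factor is cancelled. *)
Lemma cube_root_unity (x : L) : x ^+ 3 = 1 -> x != 1 -> x * x = x + 1.
Proof.
move=> x3 x_neq1; apply: eq2; have x1_neq0 : x + 1 != 0.
  by apply: contra x_neq1 => /eqP/eq2 ->.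
apply: (mulfI x1_neq0); rewrite mulr0.
transitivity (x * (x * x) + 1); first by to_char2; ring.
by rewrite -expr2 -exprS x3 addrr_pchar2.
Qed.

Variable w : L.
Hypothesis w2 : w * w = w + 1.

Let w2' : mul2 w w = add2 w one2 := w2.
Ltac ring2 := to_char2; ring [w2'].

Variable deg : nat.
Hypotheses (deg_odd : odd deg) (s_pow : forall x, s x = x ^+ (2 ^ deg)).
Hypothesis s6 : forall x, s (s (s (s (s (s x))))) = x.

Definition inK (x : L) := s (s x) = x.

Lemma w_neq0 : w != 0.
Proof. by apply/eqP=> w0; move/eqP: w2; rewrite w0 mul0r add0r eq_sym oner_eq0. Qed.

Lemma w1_neq0 : w + 1 != 0.
Proof. by rewrite -w2 mulf_neq0 ?w_neq0. Qed.

(** Since [w ^+ 4 = w] and [deg] is odd, the power [2 ^ deg] acts on [w] as squaring. *)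
Lemma sw : s w = w + 1.
Proof.
rewrite s_pow -(odd_double_half deg) deg_odd addnC expnD exprM -w2 -expr2.
congr (_ ^+ 2); elim: deg./2 => [|j IHj]; first by rewrite expr1.
rewrite doubleS expnS expnS mulnA mulnC exprM IHj.
by rewrite -[(2 * 2)%N]/4%N !exprS expr0; ring2.
Qed.

Lemma ssw : inK w.
Proof. by rewrite /inK sw rmorphD rmorph1 sw; ring2. Qed.

Lemma inKD x y : inK x -> inK y -> inK (x + y).
Proof. by rewrite /inK !rmorphD => -> ->. Qed.

Lemma inKM x y : inK x -> inK y -> inK (x * y).
Proof. by rewrite /inK !rmorphM => -> ->. Qed.

Lemma inKV x : inK x -> inK x^-1.
Proof. by rewrite /inK !fmorphV => ->. Qed.

Lemma inKs x : inK x -> inK (s x).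
Proof. by rewrite /inK => ->. Qed.

Lemma inK1 : inK 1.
Proof. by rewrite /inK !rmorph1. Qed.

Lemma inK0 : inK 0.
Proof. by rewrite /inK !rmorph0. Qed.

(* A zero of [X^2 + w X + 1] is a fifth root of unity, and [s \o s] inverts
   those, since [4 ^ deg = -1] modulo 5. *)
Lemma aniso x y : inK x -> inK y ->
  x * x + w * x * y + y * y = 0 -> x = 0 /\ y = 0.
Proof.
move=> xK yK e; have [y0|y_neq0] := eqVneq y 0.
  by move/eqP: e; rewrite y0 !mulr0 !addr0 mulf_eq0 orbb => /eqP ->.
pose v := x / y; have vK : inK v by apply/inKM/inKV.
have ev : v * v + w * v + 1 = 0.
  apply: (mulIf y_neq0); apply: (mulIf y_neq0); rewrite !mul0r -[RHS]e.
  have -> : x = v * y by rewrite divfK.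
  by ring2.
have v5 : v ^+ 5 = 1.
  rewrite !exprS expr0; apply: eq2.
  (* The factorisation of [X^5 + 1] over the field of four elements. *)
  transitivity ((v + 1) * (v * v + (w + 1) * v + 1) * (v * v + w * v + 1)).
    by ring2.
  by rewrite ev mulr0.
have v4 : v ^+ 4 = v.
  rewrite -[RHS]vK !s_pow -exprM -expnMn -[RHS](expr_mod _ v5); congr (v ^+ _).
  rewrite -(odd_double_half deg) deg_odd expnD -mul2n expnM.
  by rewrite -modnMmr -modnXm exp1n.
have v1 : v = 1.
  apply: eq2; apply/eqP; rewrite -sqrf_eq0 expr2; apply/eqP.
  transitivity (v * v + 1); first by ring2.
  by rewrite -v5 exprS v4; ring2.
by case/eqP: w_neq0; rewrite -[RHS]ev v1; ring2.
Qed.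

Lemma inK_div c y z : c != 0 -> s (s y) = c * y -> s (s z) = c * z -> inK (y / z).
Proof.
by move=> c0 sy sz; rewrite /inK !fmorph_div sy sz -mulf_div divff ?mul1r.
Qed.

(** * Vectors and matrices with entries in [K] *)

Local Notation bar := (map_mx s).
Definition matK m n (A : 'M[L]_(m, n)) := bar (bar A) = A.

Lemma matKP m n (A : 'M[L]_(m, n)) : matK A <-> forall i j, inK (A i j).
Proof.
split=> [AK i j|AK]; first by rewrite /inK -{2}AK !mxE.
by apply/matrixP=> i j; rewrite !mxE AK.
Qed.

Lemma barD m n (A B : 'M[L]_(m, n)) : bar (A + B) = bar A + bar B.
Proof. exact: map_mxD. Qed.

Lemma barZ m n a (A : 'M[L]_(m, n)) : bar (a *: A) = s a *: bar A.
Proof. exact: map_mxZ. Qed.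

Lemma matKD m n (A B : 'M[L]_(m, n)) : matK A -> matK B -> matK (A + B).
Proof. by rewrite /matK !barD => -> ->. Qed.

Lemma matKZ m n a (A : 'M[L]_(m, n)) : inK a -> matK A -> matK (a *: A).
Proof. by rewrite /matK !barZ => -> ->. Qed.

Lemma matKbar m n (A : 'M[L]_(m, n)) : matK A -> matK (bar A).
Proof. by rewrite /matK => ->. Qed.

Lemma dotK n (a b : 'rV[L]_n) : matK a -> matK b -> inK (dot a b).
Proof. by move=> aK bK; rewrite /inK -!dot_map aK bK. Qed.

(* A kernel vector normalised to have an entry 1 has a nonzero trace to the
   fixed field of [s \o s], because 1 + 1 + 1 = 1. *)
Lemma matK_kernel m n (A : 'M[L]_(m, n)) : (n < m)%N -> matK A ->
  exists c : 'rV[L]_m, [/\ c != 0, matK c & c *m A = 0].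
Proof.
move=> ltnm AK.
have: kermx A != 0.
  by rewrite -mxrank_eq0 mxrank_ker -lt0n subn_gt0 (leq_ltn_trans (rank_leq_col A)).
case/rowV0Pn=> c0 /sub_kermxP c0A /rV0Pn[j c0j].
pose c1 := (c0 0 j)^-1 *: c0.
have c1A : c1 *m A = 0 by rewrite -scalemxAl c0A scaler0.
pose rho (c : 'rV[L]_m) := bar (bar c).
have rhoA c : c *m A = 0 -> rho c *m A = 0.
  by move=> cA; rewrite -AK -!map_mxM cA !map_mx0.
exists (c1 + rho c1 + rho (rho c1)); split.
- apply/rV0Pn; exists j; rewrite !mxE mulVf // !rmorph1.
  suff -> : 1 + 1 + 1 = 1 :> L by rewrite oner_neq0.
  by ring2.
- apply/matKP=> i j'; rewrite /inK !mxE; set x := _^-1 * _.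
  by rewrite !rmorphD s6; ring2.
by rewrite !mulmxDl !rhoA ?c1A ?addr0 // rhoA.
Qed.

(** The four vectors are the rows of a matrix over [K] with too few columns, so [matK_kernel]
    applies. *)
Lemma matK_dep4 n (x0 x1 x2 x3 : 'rV[L]_n) : (n < 4)%N ->
  matK x0 -> matK x1 -> matK x2 -> matK x3 ->
  exists c0 c1 c2 c3, [/\ [/\ inK c0, inK c1, inK c2 & inK c3],
    ~ [/\ c0 = 0, c1 = 0, c2 = 0 & c3 = 0]
  & c0 *: x0 + c1 *: x1 + c2 *: x2 + c3 *: x3 = 0].
Proof.
move=> n4 K0 K1 K2 K3; pose A := \matrix_(i < 4) [:: x0; x1; x2; x3]`_i.
have AK : matK A.
  have rowK (x : 'rV[L]_n) : matK x -> forall j, inK (x 0 j).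
    by move/matKP=> xK j.
  by apply/matKP=> -[[|[|[|[|i]]]] //= ilt] j; rewrite !mxE /=; apply: rowK.
have [c [nz_c /matKP cK cA]] := matK_kernel n4 AK.
pose i1 : 'I_4 := lift ord0 ord0; pose i2 : 'I_4 := lift ord0 (lift ord0 ord0).
pose i3 : 'I_4 := lift ord0 (lift ord0 (lift ord0 ord0)).
exists (c 0 0), (c 0 i1), (c 0 i2), (c 0 i3); split=> //.
  case=> c0 c1 c2 c3; case/eqP: nz_c; apply/rowP=> i; rewrite mxE.
  case: i => [[|[|[|[|i]]]] //= ilt]; [rewrite -[RHS]c0 | rewrite -[RHS]c1
    | rewrite -[RHS]c2 | rewrite -[RHS]c3]; by congr (c _ _); apply: val_inj.
move: cA; rewrite mulmx_sum_row !big_ord_recl big_ord0 addr0 !addrA !rowK /=.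
by [].
Qed.

(** [z] is a Lagrange resolvent: the projection of [x] to the eigenspace of [s \o s] for [w], where
    the factor 1/3 is 1. *)
Lemma w_component_eigen (x : L) :
  let z := x + (w + 1) * s (s x) + w * s (s (s (s x))) in s (s z) = w * z.
Proof.
by rewrite /= !rmorphD !rmorphM rmorphD rmorph1 rmorphD rmorph1 ssw s6; ring2.
Qed.

(** * [L] as a cubic Kummer extension of [K] generated by [t] *)

Section CubicGenerator.

Variable t : L.
Hypotheses (t_neq0 : t != 0) (sst : s (s t) = (w + 1) * t).

(** The coordinates of [x] in the [K]-basis [1, t, t * t]: each numerator is a Lagrange resolvent
    with the same eigenvalue under [s \o s] as the power of [t] below it. *)
Definition comp0 (x : L) : L := x + s (s x) + s (s (s (s x))).
Definition comp1 (x : L) : L := (x + w * s (s x) + (w + 1) * s (s (s (s x)))) / t.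
Definition comp2 (x : L) : L :=
  (x + (w + 1) * s (s x) + w * s (s (s (s x)))) / (t * t).

Lemma comp0K (x : L) : inK (comp0 x).
Proof. by rewrite /inK /comp0 !rmorphD s6; ring2. Qed.

Lemma comp1K (x : L) : inK (comp1 x).
Proof.
apply: (inK_div w1_neq0) => //.
by rewrite !rmorphD !rmorphM !rmorphD !rmorph1 ssw s6; ring2.
Qed.

Lemma comp2K (x : L) : inK (comp2 x).
Proof.
apply: (inK_div w_neq0); first exact: w_component_eigen.
by rewrite !rmorphM sst; ring2.
Qed.

(** The three resolvents add up to [3 x = x], because [1 + w + w * w = 0]. *)
Lemma compE (x : L) : x = comp0 x + t * comp1 x + t * t * comp2 x.
Proof.
rewrite ![_ * comp1 x]mulrC ![_ * comp2 x]mulrC !divfK ?mulf_neq0 // /comp0.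
by ring2.
Qed.

(** Two applications of [s \o s] give a Vandermonde system in the three terms, inverted with the
    cube roots of unity. *)
Lemma comp_inj (a b c : L) : inK a -> inK b -> inK c ->
  a + t * b + t * t * c = 0 -> [/\ a = 0, b = 0 & c = 0].
Proof.
move=> aK bK cK e0.
have rho (x y z : L) : inK x -> inK y -> inK z -> x + t * y + t * t * z = 0 ->
    x + t * ((w + 1) * y) + t * t * (w * z) = 0.
  move=> xK yK zK /(congr1 (s \o s)).
  by rewrite /= !rmorphD !rmorphM !rmorph0 xK yK zK sst => <-; ring2.
have e1 := rho _ _ _ aK bK cK e0.
have wK := ssw; have w1K := inKD wK inK1.
have e2 := rho _ _ _ aK (inKM w1K bK) (inKM wK cK) e1.
set E0 := LHS in e0; set E1 := LHS in e1; set E2 := LHS in e2.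
have a0 : a = E0 + E1 + E2 by rewrite /E0 /E1 /E2; ring2.
have b0 : t * b = E0 + w * E1 + (w + 1) * E2 by rewrite /E0 /E1 /E2; ring2.
have c0 : t * t * c = E0 + (w + 1) * E1 + w * E2 by rewrite /E0 /E1 /E2; ring2.
rewrite e0 e1 e2 ?mulr0 ?addr0 in a0 b0 c0; split=> //.
  by move/eqP: b0; rewrite mulf_eq0 (negPf t_neq0) => /eqP.
by move/eqP: c0; rewrite !mulf_eq0 (negPf t_neq0) => /eqP.
Qed.

Lemma K_dep4 (x0 x1 x2 x3 : L) :
  exists c0 c1 c2 c3, [/\ [/\ inK c0, inK c1, inK c2 & inK c3],
    ~ [/\ c0 = 0, c1 = 0, c2 = 0 & c3 = 0]
  & c0 * x0 + c1 * x1 + c2 * x2 + c3 * x3 = 0].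
Proof.
pose e : 'rV[L]_3 := \row_i [:: 1; t; t * t]`_i.
pose v x : 'rV[L]_3 := \row_i [:: comp0 x; comp1 x; comp2 x]`_i.
have vE x : x = dot (v x) e.
  rewrite /dot !big_ord_recl big_ord0 !mxE /= addr0 {1}(compE x).
  by rewrite mulr1 addrA ![_ * comp1 x]mulrC ![_ * comp2 x]mulrC.
have vK x : matK (v x).
  apply/matKP=> i [[|[|[|j]]] //= jlt]; rewrite !mxE /=.
  - exact: comp0K.
  - exact: comp1K.
  - exact: comp2K.
have [c0 [c1 [c2 [c3 [cK nz_c ce]]]]] :=
  matK_dep4 (isT : 3 < 4)%N (vK x0) (vK x1) (vK x2) (vK x3).
exists c0, c1, c2, c3; split=> //.
by rewrite (vE x0) (vE x1) (vE x2) (vE x3) -!dotZl -!dotDl ce dot0l.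
Qed.

(* The relations between [a0, ..., a3] form a [K]-space stable under
   [psi : e0 -> e1 -> e2 -> e3 -> e0 + w e2], and no proper nonzero subspace of
   [K^4] is: [psi^2] acts on [<e0, e2>] with the anisotropic characteristic
   polynomial [X^2 + w X + 1]. *)
Lemma psi_stable_relations (a0 a1 a2 a3 : L) :
  (forall m0 m1 m2 m3, inK m0 -> inK m1 -> inK m2 -> inK m3 ->
     m0 * a0 + m1 * a1 + m2 * a2 + m3 * a3 = 0 ->
     s m3 * a0 + s m0 * a1 + (s m1 + w * s m3) * a2 + s m2 * a3 = 0) ->
  [/\ a0 = 0, a1 = 0, a2 = 0 & a3 = 0].
Proof.
move=> psiP.
have wK := ssw.
(* The square of [psi] is [K]-linear and acts separately on the even and on the odd coordinates. *)
have psi2P (m0 m1 m2 m3 : L) : inK m0 -> inK m1 -> inK m2 -> inK m3 ->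
    m0 * a0 + m1 * a1 + m2 * a2 + m3 * a3 = 0 ->
    m2 * a0 + m3 * a1 + (m0 + w * m2) * a2 + (m1 + (w + 1) * m3) * a3 = 0.
  move=> K0 K1 K2 K3 /psiP-/(_ K0 K1 K2 K3)/psiP.
  rewrite !rmorphD !rmorphM sw K0 K1 K2 K3; apply; rewrite ?K0 ?K1 ?K2 ?K3.
  - exact: inKs.
  - exact: inKs.
  - by apply: inKD; [apply: inKs | apply: inKM => //; apply: inKs].
  - exact: inKs.
(* Cramer's rule: in characteristic 2 the quadratic form is the determinant of the system. *)
have solve2 (c m0 m2 x y : L) : m0 * m0 + c * m0 * m2 + m2 * m2 != 0 ->
    m0 * x + m2 * y = 0 -> m2 * x + (m0 + c * m2) * y = 0 -> x = 0 /\ y = 0.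
  move=> d_neq0 e1 e2.
  have ex : (m0 * m0 + c * m0 * m2 + m2 * m2) * x = 0.
    transitivity ((m0 + c * m2) * (m0 * x + m2 * y)
                   + m2 * (m2 * x + (m0 + c * m2) * y)); first by ring2.
    by rewrite e1 e2 !mulr0 addr0.
  have ey : (m0 * m0 + c * m0 * m2 + m2 * m2) * y = 0.
    transitivity (m2 * (m0 * x + m2 * y)
                   + m0 * (m2 * x + (m0 + c * m2) * y)); first by ring2.
    by rewrite e1 e2 !mulr0 addr0.
  move/eqP: ex; move/eqP: ey; rewrite !mulf_eq0 (negPf d_neq0) /=.
  by move=> /eqP -> /eqP ->.
have even (m0 m2 : L) : inK m0 -> inK m2 -> ~ (m0 = 0 /\ m2 = 0) ->
    m0 * a0 + m2 * a2 = 0 -> [/\ a0 = 0, a1 = 0, a2 = 0 & a3 = 0].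
  move=> K0 K2 nz e1.
  have d_neq0 : m0 * m0 + w * m0 * m2 + m2 * m2 != 0.
    by apply/eqP=> /(aniso K0 K2)/nz.
  have e1' : m0 * a0 + 0 * a1 + m2 * a2 + 0 * a3 = 0.
    by rewrite !mul0r !addr0.
  have := psi2P _ _ _ _ K0 inK0 K2 inK0 e1'.
  rewrite !(mulr0, mul0r, addr0) => /(solve2 _ _ _ _ _ d_neq0 e1)[-> ->].
  (* [psi] turns the even relation into an odd one, whose determinant is the image under [s] of the
     previous one. *)
  have o1 : 0 * a0 + s m0 * a1 + 0 * a2 + s m2 * a3 = 0.
    by rewrite -[RHS](psiP _ _ _ _ K0 inK0 K2 inK0 e1') rmorph0 mulr0 addr0.
  have := psi2P _ _ _ _ inK0 (inKs K0) inK0 (inKs K2) o1.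
  move: o1; rewrite !(mulr0, mul0r, addr0, add0r) => o1 /(solve2 _ _ _ _ _ _ o1).
  case=> [|-> ->] //; apply: contraNneq d_neq0 => d0.
  by rewrite -(fmorph_eq0 s) !rmorphD !rmorphM sw d0.
have mixed (m0 m1 m2 m3 : L) : inK m0 -> inK m1 -> inK m2 -> inK m3 ->
    ~ (m0 = 0 /\ m2 = 0) -> m0 * a0 + m1 * a1 + m2 * a2 + m3 * a3 = 0 ->
    [/\ a0 = 0, a1 = 0, a2 = 0 & a3 = 0].
  move=> K0 K1 K2 K3 nz e0.
  have w1K := inKD wK inK1.
  have e1 := psi2P _ _ _ _ K0 K1 K2 K3 e0.
  have e2 := psi2P _ _ _ _ K2 K3 (inKD K0 (inKM wK K2)) (inKD K1 (inKM w1K K3)) e1.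
  (* By Cayley-Hamilton, [psi^4 + (w + 1) psi^2 + 1] kills the odd coordinates; on the even ones it
     equals [psi^2], which is injective there. *)
  apply: (even m2 (m0 + w * m2)) => //; first by apply/inKD/inKM.
    by case=> m20 m00; apply: nz; move: m00; rewrite m20 mulr0 addr0.
  set E0 := LHS in e0; set E1 := LHS in e1; set E2 := LHS in e2.
  have -> : m2 * a0 + (m0 + w * m2) * a2 = E2 + (w + 1) * E1 + E0.
    by rewrite /E0 /E1 /E2; ring2.
  by rewrite e0 e1 e2 mulr0 !addr0.
have [m0 [m1 [m2 [m3 [[K0 K1 K2 K3] nz e]]]]] := K_dep4 a0 a1 a2 a3.
have [/andP[/eqP m00 /eqP m20]|] := boolP ((m0 == 0) && (m2 == 0)); last first.
  move=> nz02; apply: mixed e => // -[m00 m20].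
  by rewrite m00 m20 eqxx in nz02.
(* A purely odd relation is moved to the even coordinates by [psi]. *)
have := psiP _ _ _ _ K0 K1 K2 K3 e; apply: mixed; try exact: inKs.
  by apply: inKD; [apply: inKs | apply: inKM => //; apply: inKs].
move=> [/eqP m30]; rewrite (eqP m30) mulr0 addr0 => /eqP m10.
by apply: nz; move: m10 m30; rewrite !fmorph_eq0 => /eqP -> /eqP ->.
Qed.

Lemma vec_comp n (v : 'rV[L]_n) : exists a b c : 'rV[L]_n,
  [/\ matK a, matK b, matK c & v = a + t *: b + (t * t) *: c].
Proof.
exists (map_mx comp0 v), (map_mx comp1 v), (map_mx comp2 v); split.
- by apply/matKP=> i j; rewrite !mxE; apply: comp0K.
- by apply/matKP=> i j; rewrite !mxE; apply: comp1K.
- by apply/matKP=> i j; rewrite !mxE; apply: comp2K.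
by apply/rowP=> j; rewrite !mxE; apply: compE.
Qed.

(** * The semilinear system satisfied by a relation [lam] *)

Section SemilinearSystem.

Variables lam p0 p1 p2 p3 : 'rV[L]_3.
Hypotheses (K0 : matK p0) (K1 : matK p1) (K2 : matK p2) (K3 : matK p3).
Hypothesis spanK : forall g : 'rV[L]_3, matK g ->
  [/\ dot g p0 = 0, dot g p1 = 0, dot g p2 = 0 & dot g p3 = 0] ->
  [/\ dot g (bar p0) = 0, dot g (bar p1) = 0, dot g (bar p2) = 0
    & dot g (bar p3) = 0] -> g = 0.
Hypotheses (e0 : dot lam (bar p1) = t * dot lam p0)
  (e1 : dot lam (bar p2) = t * dot lam p1)
  (e2 : dot lam (bar p3) = t * dot lam p2)
  (e3 : dot lam (bar (p0 + w *: p2)) = t * dot lam p3).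

Let vanish := [/\ dot lam p0 = 0, dot lam p1 = 0, dot lam p2 = 0 & dot lam p3 = 0].

Let wK := ssw.
Let K4 : matK (p0 + w *: p2) := matKD K0 (matKZ wK K2).

(** The system makes [lam] orthogonal to the [bar p_i] as well. Its three components over [K]
    inherit all these orthogonalities, and [spanK] kills them. *)
Lemma vanish_lam0 : vanish -> lam = 0.
Proof.
case=> a0 a1 a2 a3; move: e0 e1 e2 e3; rewrite a0 a1 a2 a3 !mulr0.
rewrite barD barZ dotDr dotZr => b1 b2 b3; rewrite b2 mulr0 addr0 => b0.
have [x [y [z [xK yK zK lamE]]]] := vec_comp lam.
have split3 p : matK p -> dot lam p = 0 ->
    [/\ dot x p = 0, dot y p = 0 & dot z p = 0].
  move=> pK; rewrite lamE !dotE; apply: comp_inj; exact: dotK.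
have [x0 y0 z0] := split3 _ K0 a0; have [x1 y1 z1] := split3 _ K1 a1.
have [x2 y2 z2] := split3 _ K2 a2; have [x3 y3 z3] := split3 _ K3 a3.
have [x0' y0' z0'] := split3 _ (matKbar K0) b0.
have [x1' y1' z1'] := split3 _ (matKbar K1) b1.
have [x2' y2' z2'] := split3 _ (matKbar K2) b2.
have [x3' y3' z3'] := split3 _ (matKbar K3) b3.
rewrite lamE (spanK xK) // (spanK yK) // (spanK zK) //.
by rewrite !scaler0 !addr0.
Qed.

(** * The case where [lam] is orthogonal to a nonzero vector of [K^3] *)

Section Degenerate.

Variable k : 'rV[L]_3.
Hypotheses (kK : matK k) (k_neq0 : k != 0) (lam_k : dot lam k = 0).

(** The functional [dot lam] on [K^3] kills [k], so its values form a [K]-space of dimension at most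
    2. *)
Lemma degenerate_dep3 (q0 q1 q2 : 'rV[L]_3) : matK q0 -> matK q1 -> matK q2 ->
  exists c0 c1 c2, [/\ [/\ inK c0, inK c1 & inK c2],
    ~ [/\ c0 = 0, c1 = 0 & c2 = 0]
  & c0 * dot lam q0 + c1 * dot lam q1 + c2 * dot lam q2 = 0].
Proof.
move=> Q0 Q1 Q2.
have [c0 [c1 [c2 [c3 [[C0 C1 C2 C3] nz ce]]]]] :=
  matK_dep4 (isT : 3 < 4)%N Q0 Q1 Q2 kK.
exists c0, c1, c2; split=> // [[c00 c10 c20]|].
  apply: nz; split=> //; move/eqP: ce.
  by rewrite c00 c10 c20 !scale0r !add0r scaler_eq0 (negPf k_neq0) orbF => /eqP.
by move/(congr1 (dot lam)): ce; rewrite !dotE lam_k mulr0 addr0.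
Qed.

(** With [b := dot lam r], the values [a] and [t * a] already span the value space, which contains
    [b] and [t * b]. Expanding both and comparing coefficients of [1, t, t * t] leaves [b] in
    [K a]. *)
Lemma degenerate_ratio (q q' r r' : 'rV[L]_3) :
  matK q -> matK q' -> matK r -> matK r' ->
  dot lam q' = t * dot lam q -> dot lam r' = t * dot lam r -> dot lam q != 0 ->
  inK (dot lam r / dot lam q).
Proof.
move=> qK q'K rK r'K eq' er'; set a := dot lam q; set b := dot lam r => a_neq0.
have ratio x y z v : inK x -> inK y -> inK z -> ~ [/\ x = 0, y = 0 & z = 0] ->
    x * a + y * (t * a) + z * v = 0 ->
    exists x1 y1, [/\ inK x1, inK y1 & v = (x1 + t * y1) * a].
  move=> xK yK zK nz e.
  have [z0|z_neq0] := eqVneq z 0.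
    case: nz; move: e; rewrite z0 mul0r addr0 mulrA -mulrDl => /eqP.
    rewrite mulf_eq0 (negPf a_neq0) orbF => /eqP e.
    have [|-> -> _ //] := @comp_inj x y 0 xK yK inK0.
    by rewrite mulr0 addr0 [t * y]mulrC.
  exists (x / z), (y / z); split; [exact/inKM/inKV | exact/inKM/inKV |].
  apply: (mulfI z_neq0); transitivity ((z * (x / z) + t * (z * (y / z))) * a).
    by rewrite ![z * (_ / _)]mulrC !divfK //; apply: eq2; rewrite -[RHS]e; ring2.
  by ring2.
have [x [y [z [[xK yK zK] nz]]]] := degenerate_dep3 qK q'K rK.
rewrite eq' => /(ratio _ _ _ _ xK yK zK nz)[x1 [y1 [x1K y1K bE]]].
have [x' [y' [z' [[x'K y'K z'K] nz']]]] := degenerate_dep3 qK q'K r'K.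
rewrite eq' er' => /(ratio _ _ _ _ x'K y'K z'K nz')[x2 [y2 [x2K y2K tbE]]].
have [] := @comp_inj x2 (y2 + x1) y1 x2K (inKD y2K x1K) y1K.
  apply: (mulIf a_neq0); rewrite mul0r.
  transitivity ((x2 + t * y2) * a + t * ((x1 + t * y1) * a)); first by ring2.
  by rewrite -bE -tbE -/b addrr_pchar2.
by move=> _ _ y10; rewrite /b bE y10 mulr0 addr0 mulfK.
Qed.

(* Rescaling [lam] so that all the values [b_i := dot lam p_i] lie in [K], the
   components of [lam] become proportional up to conjugation, which yields
   [b_(i+1) = c * s b_i] and then a zero [c * s c] of [X^2 + w X + 1]. *)
Lemma degenerate_vanish : vanish.
Proof.
have [/and4P[/eqP ? /eqP ? /eqP ? /eqP ?] //|nz] :=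
  boolP [&& dot lam p0 == 0, dot lam p1 == 0, dot lam p2 == 0 & dot lam p3 == 0].
have [q [q' [qK q'K eq' q_neq0]]] : exists q q', [/\ matK q, matK q',
    dot lam q' = t * dot lam q & dot lam q != 0].
  move: nz; rewrite !negb_and => /or4P[] nz.
  - by exists p0, (bar p1); split=> //; apply: matKbar.
  - by exists p1, (bar p2); split=> //; apply: matKbar.
  - by exists p2, (bar p3); split=> //; apply: matKbar.
  - by exists p3, (bar (p0 + w *: p2)); split=> //; apply: matKbar.
set a := dot lam q in eq' q_neq0.
have [x [y [z [xK yK zK lamE]]]] := vec_comp (a^-1 *: lam).
(* After the rescaling the value at [p] lies in [K] and the value at [p'] in [t K], so a single
   coordinate of each survives. *)
have split3 p p' : matK p -> matK p' -> dot lam p' = t * dot lam p ->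
    let b := dot lam p / a in
    [/\ inK b, dot x p = b, dot y p = 0, dot x p' = 0 & dot y p' = b].
  move=> pK p'K e b.
  have bK : inK b := degenerate_ratio qK q'K pK p'K eq' e q_neq0.
  have := @comp_inj (dot x p + b) (dot y p) (dot z p) (inKD (dotK xK pK) bK)
    (dotK yK pK) (dotK zK pK).
  have := @comp_inj (dot x p') (dot y p' + b) (dot z p') (dotK xK p'K)
    (inKD (dotK yK p'K) bK) (dotK zK p'K).
  have E : dot x p + t * dot y p + t * t * dot z p = b.
    by rewrite -!dotZl -!dotDl -lamE dotZl mulrC.
  have E' : dot x p' + t * dot y p' + t * t * dot z p' = t * b.
    by rewrite -!dotZl -!dotDl -lamE dotZl mulrC e -mulrA.
  case=> [|x'0 y'b _].
    by rewrite -[RHS](addrr_pchar2 L2 (t * b)) -{1}E'; ring2.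
  case=> [|xb y0 _].
    by rewrite -[RHS](addrr_pchar2 L2 b) -{1}E; ring2.
  by split=> //; apply: eq2.
have [b0K x0 y0 x1' y1'] := split3 _ _ K0 (matKbar K1) e0.
have [b1K x1 y1 x2' y2'] := split3 _ _ K1 (matKbar K2) e1.
have [b2K x2 y2 x3' y3'] := split3 _ _ K2 (matKbar K3) e2.
have [b3K x3 y3 x4' y4'] := split3 _ _ K3 (matKbar K4) e3.
set b0 := dot lam p0 / a in b0K x0 y1'; set b1 := dot lam p1 / a in b1K x1 y2'.
set b2 := dot lam p2 / a in b2K x2 y3'; set b3 := dot lam p3 / a in b3K x3 y4'.
have x0' : dot x (bar p0) = 0.
  by rewrite -x4' barD barZ dotDr dotZr x2' mulr0 addr0.
have [d0 [d1 [dK0 dK1 nz_d de]]] : exists d0 d1,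
    [/\ inK d0, inK d1, ~ (d0 = 0 /\ d1 = 0) & d0 *: x + d1 *: bar y = 0].
  (* [x] and [bar y] are orthogonal to every [bar p_i], while [bar x] and [y] are orthogonal to
     every [p_i]. A dependence between the four thus equates two vectors that [spanK] shows to be
     0. *)
  have [c0 [c1 [c2 [c3 [[C0 C1 C2 C3] nz_c ce]]]]] :=
    matK_dep4 (isT : 3 < 4)%N xK (matKbar yK) (matKbar xK) yK.
  have barx p : matK p -> dot x (bar p) = 0 -> dot (bar x) p = 0.
    by move=> pK xp; rewrite -pK dot_map xp rmorph0.
  have bary p : dot y p = 0 -> dot (bar y) (bar p) = 0.
    by move=> yp; rewrite dot_map yp rmorph0.
  have ce' : c0 *: x + c1 *: bar y = c2 *: bar x + c3 *: y.
    apply/rowP=> i; move/rowP/(_ i): ce; rewrite !mxE => ce; apply: eq2.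
    by rewrite addrA.
  have g0 : c0 *: x + c1 *: bar y = 0.
    apply: spanK; first by apply: matKD; apply: matKZ => //; apply: matKbar.
      by rewrite ce' !dotDl !dotZl !barx // y0 y1 y2 y3 !mulr0 !addr0.
    by rewrite !dotDl !dotZl !bary // x0' x1' x2' x3' !mulr0 !addr0.
  have [/andP[/eqP c00 /eqP c10]|nz01] := boolP ((c0 == 0) && (c1 == 0)).
    exists (s c2), (s c3); split; try exact: inKs.
      move=> [/eqP c20 /eqP c30]; apply: nz_c.
      by move: c20 c30; rewrite !fmorph_eq0 => /eqP -> /eqP ->.
    by move/(congr1 bar): ce'; rewrite g0 !barD !barZ xK map_mx0 => <-.
  by exists c0, c1; split=> // -[c00 c10]; rewrite c00 c10 !eqxx in nz01.
have step p (b b' : L) : matK p -> dot x p = b' -> dot y (bar p) = b ->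
    d0 * b' + d1 * s b = 0.
  move=> pK <- <-; rewrite -dot_map pK -!dotZl -dotDl de; exact: dot0l.
have s0 := step _ _ _ K1 x1 y1'; have s1 := step _ _ _ K2 x2 y2'.
have s2 := step _ _ _ K3 x3 y3'.
have s3 : d0 * (b0 + w * b2) + d1 * s b3 = 0.
  by apply: step K4 _ y4'; rewrite dotDr dotZr x0 x2.
have b_all0 : [/\ b0 = 0, b1 = 0, b2 = 0 & b3 = 0].
  have [d00|d0_neq0] := eqVneq d0 0.
    have d1_neq0 : d1 != 0 by apply/eqP=> d10; apply: nz_d.
    move: s0 s1 s2 s3; rewrite d00 !mul0r !add0r.
    do 4![move/eqP; rewrite mulf_eq0 (negPf d1_neq0) fmorph_eq0 => /eqP ->].
    by [].
  pose c := d1 / d0.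
  have stepc u v : d0 * v + d1 * u = 0 -> v = c * u.
    move=> e; apply: (mulfI d0_neq0); transitivity (d1 * u); first exact: eq2.
    by rewrite mulrA [d0 * c]mulrC divfK.
  have cK : inK c by apply/inKM/inKV.
  have E1 := stepc _ _ s0; have E2 := stepc _ _ s1; have E3 := stepc _ _ s2.
  have E4 := stepc _ _ s3.
  have b00 : b0 = 0.
    have [//|b0_neq0] := eqVneq b0 0.
    have [|_ /eqP] := @aniso (c * s c) 1 (inKM cK (inKs cK)) inK1.
      apply: (mulIf b0_neq0); rewrite mul0r.
      transitivity (b0 + w * b2 + c * s b3).
        by rewrite E3 E2 E1 !(rmorphM, b0K, cK); ring2.
      by rewrite E4 addrr_pchar2.
    by rewrite oner_eq0.
  by move: E1 E2 E3; rewrite b00 rmorph0 mulr0 => ->; rewrite rmorph0 mulr0 => ->;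
     rewrite rmorph0 mulr0 => ->.
have unscale b : b / a = 0 -> b = 0.
  by move/eqP; rewrite mulf_eq0 invr_eq0 (negPf q_neq0) orbF => /eqP.
by case: b_all0 => /unscale ? /unscale ? /unscale ? /unscale ?.
Qed.

End Degenerate.

(** Outside the degenerate case [dot lam] is injective on [K^3], so a relation between values lifts
    to one between vectors, and conjugating the latter gives the stability under [psi]. *)
Lemma semilinear_system_trivial : lam = 0.
Proof.
apply: vanish_lam0.
have [/and4P[/eqP ? /eqP ? /eqP ? /eqP ?] //|nz] :=
  boolP [&& dot lam p0 == 0, dot lam p1 == 0, dot lam p2 == 0 & dot lam p3 == 0].
have inj k : matK k -> dot lam k = 0 -> k = 0.
  move=> kK lam_k; have [//|k_neq0] := eqVneq k 0.
  by case: (degenerate_vanish kK k_neq0 lam_k) nz => -> -> -> ->; rewrite !eqxx.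
apply: psi_stable_relations => m0 m1 m2 m3 M0 M1 M2 M3 em.
(* [dot lam k] is [t] times the given relation, and [bar k] carries the coefficients moved by
   [psi]. *)
pose k := m0 *: bar p1 + m1 *: bar p2 + m2 *: bar p3 + m3 *: bar (p0 + w *: p2).
have kK : matK k by rewrite /k; do !apply: matKD; apply: matKZ => //; apply: matKbar.
have k0 : k = 0.
  apply: inj => //; rewrite !dotDr !dotZr e0 e1 e2 e3.
  by rewrite ![_ * (t * _)]mulrCA -!mulrDr em mulr0.
move/(congr1 (fun v => dot lam (bar v))): k0.
by rewrite /k !(barD, barZ) K0 K1 K2 K3 wK map_mx0 dot0r !dotE => <-; ring2.
Qed.

End SemilinearSystem.

End CubicGenerator.

(* On the kernel of the trace [x = theta u + s theta v] with [u] and [v] in [K],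
   the summands being eigenvectors of [s \o s] for [w] and [w^2]. The
   combinations [p_i] of [u], [c], [bar v], [bar d] put the semilinear map
   induced by the four relations in companion form. *)
Lemma relation_trivial (theta : L) (x y lam : 'rV[L]_3) :
  theta != 0 -> s (s theta) = w * theta ->
  x + bar (bar x) + bar (bar (bar (bar x))) = 0 ->
  y + bar (bar y) + bar (bar (bar (bar y))) = 0 ->
  (forall g : 'rV[L]_3, bar g = g -> dot g x = 0 -> dot g y = 0 -> g = 0) ->
  dot lam x = 0 -> dot lam y = 0 ->
  dot lam (bar (bar x) + bar y) = 0 ->
  dot lam (bar x + bar (bar (bar y))) = 0 -> lam = 0.
Proof.
move=> th_neq0 ssth Tx Ty free lx ly l1 l2.
have th1_neq0 : s theta != 0 by rewrite fmorph_eq0.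
have ssth1 : s (s (s theta)) = (w + 1) * s theta by rewrite ssth rmorphM sw.
have decomp (z : 'rV[L]_3) : z + bar (bar z) + bar (bar (bar (bar z))) = 0 ->
    exists u v, [/\ matK u, matK v & z = theta *: u + s theta *: v].
  move=> Tz.
  have Tzi i : s (s (s (s (z 0 i)))) = z 0 i + s (s (z 0 i)).
    by move/rowP/(_ i): Tz; rewrite !mxE addrC => /eq2.
  (* On the kernel of the trace [s \o s] is a root of [X^2 + X + 1 = (X + w) (X + w + 1)], which
     yields the two eigencomponents. *)
  have eig (a : L) : s (s (s (s a))) = a + s (s a) ->
      [/\ s (s (s (s a) + (w + 1) * a)) = w * (s (s a) + (w + 1) * a),
          s (s (s (s a) + w * a)) = (w + 1) * (s (s a) + w * a)
        & a = s (s a) + (w + 1) * a + (s (s a) + w * a)].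
    move=> ea; rewrite !rmorphD !rmorphM rmorphD rmorph1 rmorphD rmorph1 ssw ea.
    by split; ring2.
  exists (\row_i ((s (s (z 0 i)) + (w + 1) * z 0 i) / theta)).
  exists (\row_i ((s (s (z 0 i)) + w * z 0 i) / s theta)); split.
  - apply/matKP=> i j; rewrite mxE; have [e _ _] := eig _ (Tzi j).
    exact: inK_div w_neq0 e ssth.
  - apply/matKP=> i j; rewrite mxE; have [_ e _] := eig _ (Tzi j).
    exact: inK_div w1_neq0 e ssth1.
  apply/rowP=> i; rewrite !mxE ![_ * (_ / _)]mulrC !divfK //.
  by case: (eig _ (Tzi i)).
have [u [v [uK vK xE]]] := decomp x Tx; have [c [d [cK dK yE]]] := decomp y Ty.
pose t := theta / s theta.
have t_neq0 : t != 0 by rewrite mulf_neq0 ?invr_eq0.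
have thE : theta = t * s theta by rewrite divfK.
have sst : s (s t) = (w + 1) * t.
  have th1' : (w + 1) * s theta != 0 by rewrite mulf_neq0 ?w1_neq0.
  rewrite /t !fmorph_div ssth1 ssth; apply: (mulIf th1'); rewrite divfK // -/t.
  by move: thE; set th1 := s theta => ->; ring2.
pose p0 := u + w *: bar v + w *: bar d.
pose p1 := u + (w + 1) *: bar v.
pose p2 := (w + 1) *: (u + c + bar v).
pose p3 := (w + 1) *: (u + c) + w *: bar d.
have wK := ssw; have w1K := inKD wK inK1.
have uK' := matKbar uK; have vK' := matKbar vK.
have cK' := matKbar cK; have dK' := matKbar dK.
have K0 : matK p0 by rewrite /p0; do !apply: matKD => //; apply: matKZ.
have K1 : matK p1 by rewrite /p1; do !apply: matKD => //; apply: matKZ.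
have K2 : matK p2 by apply: matKZ => //; do !apply: matKD => //.
have K3 : matK p3 by apply: matKD; apply: matKZ => //; apply: matKD.
have s_w1 : s (w + 1) = w by rewrite rmorphD rmorph1 sw; ring2.
have lv : dot lam v = t * dot lam u.
  apply: (mulfI th1_neq0); apply: eq2; rewrite -[RHS]lx xE !dotE.
  by move: thE; set th1 := s theta => ->; ring2.
have ld : dot lam d = t * dot lam c.
  apply: (mulfI th1_neq0); apply: eq2; rewrite -[RHS]ly yE !dotE.
  by move: thE; set th1 := s theta => ->; ring2.
set lu := dot lam u in lv *; set lc := dot lam c in ld *.
set lV := dot lam v in lv *; set lD := dot lam d in ld *.
(* The last two coordinates of the relation are solved for the values at [bar d] and [bar v]. *)
have ld' : t * dot lam (bar d) = (w + 1) * (lV + dot lam (bar c)).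
  apply: eq2; apply: (mulIf th1_neq0); apply: (mulfI w_neq0).
  rewrite mul0r mulr0 -[RHS]l1 xE yE !(barD, barZ) ssth1 ssth uK vK !dotE.
  by rewrite -/lu -/lV lv; move: thE; set th1 := s theta => ->; ring2.
have lv' : t * dot lam (bar v)
    = (w + 1) * dot lam (bar u) + lV + (w + 1) * dot lam (bar c).
  apply: eq2; apply: (mulIf th1_neq0); apply: (mulfI w_neq0).
  rewrite mul0r mulr0 -[RHS]l2 xE yE !(barD, barZ) ssth1 rmorphM s_w1 ssth cK dK.
  rewrite !dotE; transitivity (s theta * dot lam (bar u)
    + w * theta * dot lam (bar v) + (w + 1) * s theta * dot lam (bar c)
    + (w + 1) * (t * dot lam (bar d)) * s theta); last first.
    by move: thE; set th1 := s theta => ->; ring2.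
  by rewrite ld'; move: thE; set th1 := s theta => ->; ring2.
apply: (semilinear_system_trivial t_neq0 sst K0 K1 K2 K3).
(* The passage from [u], [c], [bar v], [bar d] to the [p_i] is invertible. *)
- have kill (g : 'rV[L]_3) :
      [/\ dot g p0 = 0, dot g p1 = 0, dot g p2 = 0 & dot g p3 = 0] ->
      [/\ dot g u = 0, dot g c = 0, dot g (bar v) = 0 & dot g (bar d) = 0].
    rewrite !dotE; move: (dot g u) (dot g c) (dot g (bar v)) (dot g (bar d)).
    move=> gu gc gv gd [].
    set E0 := (X in X = 0 -> _); set E1 := (X in _ -> X = 0 -> _).
    set E2 := (X in _ -> _ -> X = 0 -> _).
    set E3 := (X in _ -> _ -> _ -> X = 0 -> _).
    move=> z0 z1 z2 z3.
    have -> : gu = w * (E0 + E2 + E3) + (w + 1) * E1.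
      by rewrite /E0 /E1 /E2 /E3; ring2.
    have -> : gc = w * E2 + (E0 + E2 + E3) by rewrite /E0 /E2 /E3; ring2.
    have -> : gd = (w + 1) * (E2 + E3) + (E0 + E1 + E2 + E3).
      by rewrite /E0 /E1 /E2 /E3; ring2.
    have -> : gv = (w + 1) * (E0 + E1 + E2 + E3).
      by rewrite /E0 /E1 /E2 /E3; ring2.
    by rewrite z0 z1 z2 z3 !addr0 !mulr0 !addr0.
  have conj (g p : 'rV[L]_3) : matK p -> dot g (bar p) = 0 -> dot (bar g) p = 0.
    by move=> pK gp; rewrite -pK dot_map gp rmorph0.
  move=> g gK /kill[gu gc gv gd] [h0 h1 h2 h3].
  have [|hu hc hv hd] := kill (bar g); first by split; apply: conj.
  have gv' : dot g v = 0 by rewrite -gK; apply: conj.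
  have gd' : dot g d = 0 by rewrite -gK; apply: conj.
  have hv' : dot (bar g) v = 0 by apply: conj.
  have hd' : dot (bar g) d = 0 by apply: conj.
  (* [g] and [bar g] are both orthogonal to [x] and [y]. The combinations in [a0] and [a1] are fixed
     by [bar], so [free] applies, and together they determine [g]. *)
  have a0 : g + bar g = 0.
    apply: free; first by rewrite barD gK addrC.
      by rewrite xE !dotE gu gv' hu hv' !addr0 !mulr0 addr0.
    by rewrite yE !dotE gc gd' hc hd' !addr0 !mulr0 addr0.
  have a1 : w *: g + (w + 1) *: bar g = 0.
    apply: free; first by rewrite barD !barZ gK sw s_w1 addrC.
      by rewrite xE !dotE gu gv' hu hv' !mulr0 !addr0 !mulr0 addr0.
    by rewrite yE !dotE gc gd' hc hd' !mulr0 !addr0 !mulr0 addr0.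
  apply/rowP=> i; move/rowP/(_ i): a0; move/rowP/(_ i): a1; rewrite !mxE.
  move: (g 0 i) (s (g 0 i)) => a b a1 a0.
  have -> : a = (w + 1) * (a + b) + (w * a + (w + 1) * b) by ring2.
  by rewrite a0 a1 mulr0 addr0.
- rewrite /p0 /p1 !(barD, barZ) vK s_w1 !dotE -/lu -/lV.
  transitivity (t * lu + w * (t * dot lam (bar v)) + w * (t * dot lam (bar d))).
    by rewrite lv' ld' -lv; ring2.
  by ring2.
- rewrite /p1 /p2 !(barD, barZ) vK s_w1 !dotE -/lu -/lV.
  transitivity (t * lu + (w + 1) * (t * dot lam (bar v))); last by ring2.
  by rewrite lv' -lv; ring2.
- rewrite /p2 /p3 !(barD, barZ) dK s_w1 sw !dotE -/lu -/lc -/lD.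
  transitivity ((w + 1) * (t * lu + t * lc + t * dot lam (bar v))); last by ring2.
  by rewrite lv' -lv -ld; ring2.
- rewrite /p0 /p2 /p3 !(barD, barZ) vK dK s_w1 sw !dotE -/lu -/lc -/lV -/lD.
  transitivity ((w + 1) * (t * lu + t * lc) + w * (t * dot lam (bar d))).
    by rewrite ld' -lv -ld; ring2.
  by ring2.
Qed.

End SigmaAlgebra.

(** * Intermediate subspaces and the dimension bound for scattered subspaces *)

Lemma vspace_between (K : fieldType) (V : vectType K) (A U : {vspace V}) n :
  (A <= U)%VS -> (\dim A <= n <= \dim U)%N ->
  exists B : {vspace V}, [/\ (A <= B)%VS, (B <= U)%VS & \dim B = n].
Proof.
move=> sAU /andP[leAn]; rewrite -(subnKC leAn); move: (n - _)%N => k {leAn}.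
elim: k => [|k IHk] in A sAU *; first by exists A; rewrite addn0.
move=> lenU.
have [u Uu Au] : exists2 u, u \in U & u \notin A.
  apply/subvPn; apply: contraL lenU => sUA.
  by rewrite -ltnNge (leq_ltn_trans (dimvS sUA)) // addnS ltnS leq_addr.
have dimAu : \dim (A + <[u]>) = (\dim A).+1.
  rewrite dimv_disjoint_sum; last first.
    apply/eqP; rewrite -subv0; apply/subvP=> v; rewrite memv_cap memv0.
    case/andP=> Av /vlineP[a va]; apply: contraR Au => v_neq0.
    have a_neq0 : a != 0 by apply: contraNneq v_neq0 => a0; rewrite va a0 scale0r.
    by rewrite -[u](scalerK a_neq0) -va memvZ.
  rewrite dim_vline addnC; case: eqP Au => // ->; first by rewrite mem0v.
have [||B [sB sBU dB]] := IHk (A + <[u]>)%VS.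
- by rewrite subv_add sAU -memvE.
- by rewrite dimAu addSn -addnS.
- by exists B; rewrite (subv_trans (addvSl _ _) sB) dB dimAu addSnnS.
Qed.

Section ScatteredBound.

Variables (F : fieldType) (L : fieldExtType F) (V : vectType L).

Lemma dim_resVspace_leq (W : {vspace V}) :
  (\dim (resVspace W) <= \dim W * \dim {:L})%N.
Proof.
apply: leq_trans (dim_span _) _.
by rewrite size_image card_prod !card_ord.
Qed.

Definition resScal_mul (a : L) (u : resScal V) : resScal V := a *: (u : V).

Fact resScal_mul_linear a : linear (resScal_mul a).
Proof.
move=> c u v; rewrite /resScal_mul !resScal_scaleE scalerDr !scalerA.
by rewrite mulrC.
Qed.
HB.instance Definition _ a :=
  GRing.isLinear.Build F (resScal V) (resScal V) _ (resScal_mul a)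
    (resScal_mul_linear a).

Variable U : {vspace resScal V}.
Hypothesis capU : forall W : {vspace V}, \dim W = 2%N ->
  (\dim (U :&: resVspace W) <= 2)%N.
Hypothesis dimV : (2 <= \dim {:V})%N.

(** Otherwise the [L]-span of [X] would fit in a plane meeting [U] in dimension at least 3. *)
Lemma scattered_free (X : 3.-tuple (resScal V)) :
  free X -> {subset X <= U} -> free (X : seq V).
Proof.
move=> freeX sXU; rewrite /free size_tuple eqn_leq.
rewrite (leq_trans (dim_span _)) ?size_tuple //= ltnNge; apply/negP=> le2.
have [|W [sXW _ dimW]] := vspace_between (subvf <<(X : seq V)>>) (n := 2).
  by rewrite le2.
have /subvP sX : (<<X>> <= U :&: resVspace W)%VS.
  apply/span_subvP=> x Xx; rewrite memv_cap sXU //= mem_resVspace.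
  by rewrite (subvP sXW) ?memv_span.
have := leq_trans (dimvS (introT subvP sX)) (capU dimW).
by rewrite (eqP freeX) size_tuple.
Qed.

(** The [u i] are expanded in three [F]-independent vectors of [U], which are independent over [L].
    Each resulting coefficient is an [F]-combination of the [lam i], so it vanishes only
    trivially. *)
Lemma scattered_mul_free (lam : 'I_3 -> L) (u : 'I_3 -> resScal V) :
  (3 <= \dim U)%N ->
  (forall c : 'I_3 -> F, \sum_i c i *: lam i = 0 -> forall i, c i = 0) ->
  (forall i, u i \in U) -> \sum_i lam i *: (u i : V) = 0 -> forall i, u i = 0.
Proof.
move=> dimU free_lam uU sum0.
pose A := <<[seq u i | i : 'I_3]>>%VS.
have sAU : (A <= U)%VS by apply/span_subvP=> _ /imageP[i _ ->].
(* The span of the [u i] may be smaller; it is enlarged to dimension exactly 3 so that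
   [scattered_free] applies. *)
have [|B [sAB sBU dimB]] := vspace_between sAU (n := 3).
  by rewrite dimU (leq_trans (dim_span _)) // size_image card_ord.
have sz : size (vbasis B) == 3 by rewrite size_tuple dimB.
pose b := Tuple sz.
have freeb : free b := basis_free (vbasisP B).
have uE i : u i = \sum_j coord b j (u i) *: b`_j.
  apply: coord_span; rewrite (span_basis (vbasisP B)) (subvP sAB) //.
  by apply/memv_span/image_f.
have freebL : free (b : seq V).
  by apply: scattered_free freeb _ => v /vbasis_mem; apply: (subvP sBU).
have c0 j : \sum_i coord b j (u i) *: lam i = 0.
  move/freeP: freebL => /(_ (fun j => \sum_i coord b j (u i) *: lam i)) -> //.
  rewrite -[RHS]sum0.
  transitivity (\sum_i \sum_j (coord b j (u i) *: lam i) *: (b`_j : V)).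
    by rewrite exchange_big; apply: eq_bigr => k _; rewrite scaler_suml.
  apply: eq_bigr => i _; rewrite {2}(uE i) scaler_sumr.
  apply: eq_bigr => k _; rewrite resScal_scaleE scalerA.
  by rewrite mulrC mulr_algl.
move=> i; rewrite (uE i) big1 // => j _.
by rewrite (free_lam _ (c0 j)) scale0r.
Qed.

Lemma scattered_dim_bound : (3 <= \dim U)%N -> (3 <= \dim {:L})%N ->
  (3 * \dim U <= \dim (lspan U) * \dim {:L})%N.
Proof.
move=> dimU dimL; apply: leq_trans (dim_resVspace_leq _).
have szX : size (take 3 (vbasis {:L})) == 3 by rewrite size_takel ?size_tuple.
pose X := Tuple szX.
have freeX' : free X.
  apply: (@catl_free _ _ (drop 3 (vbasis {:L}))).
  by rewrite cat_take_drop (basis_free (vbasisP _)).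
have /freeP freeX := freeX'.
pose lam (i : 'I_3) : L := X`_i.
have lam_neq0 i : lam i != 0.
  by apply: (free_not0 freeX'); rewrite mem_nth // (eqP szX).
pose f i := linfun (resScal_mul (lam i)).
have fE i u : f i u = lam i *: (u : V) by rewrite lfunE.
have dimf i : \dim (f i @: U) = \dim U.
  apply: limg_dim_eq; suff /eqP -> : lker (f i) == 0%VS by rewrite capv0.
  by apply/lker0P=> u v; rewrite !fE => /(scalerI (lam_neq0 i)).
have /directvP : directv (\sum_(i < 3) (f i @: U)).
  apply/directv_sum_independent=> us usP sum0 i _.
  pose u i : resScal V := (lam i)^-1 *: (us i : V).
  have usE j : us j = lam j *: (u j : V) by rewrite scalerA divff ?scale1r.
  have uU j : u j \in U.
    by rewrite /u; case/memv_imgP: (usP j isT) => v Uv ->; rewrite fE scalerK.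
  suff u0 : forall j, u j = 0 by rewrite usE u0; apply: (@scaler0 L V).
  apply: (scattered_mul_free dimU freeX uU).
  by rewrite -[RHS]sum0; apply: eq_bigr => j _; rewrite usE.
rewrite /= (eq_bigr (fun _ => \dim U)) // sum_nat_const card_ord => <-.
apply: dimvS; apply/subv_sumP=> i _; apply/subvP=> _ /memv_imgP[u Uu ->].
rewrite lfunE mem_resVspace memvZ //.
by have /lspanP := subvv (lspan U); apply.
Qed.

End ScatteredBound.

(** * Powers of the Frobenius map on a finite field *)

Section Frobenius.

Variables (F : finFieldType) (L : fieldExtType F).

Local Notation q := #|F|.

Fact frob_monoid_morphism s : monoid_morphism (@frob F L s).
Proof. by split=> [|x y]; rewrite /frob ?expr1n ?exprMn. Qed.
HB.instance Definition _ s :=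
  GRing.isMonoidMorphism.Build L L (@frob F L s) (frob_monoid_morphism s).

Lemma frobD i j (x : L) : frob i (frob j x) = frob (i + j) x.
Proof. by rewrite /frob -exprM -expnD addnC. Qed.

Lemma card_finvect : #|finvect_type L| = (q ^ \dim {:L})%N.
Proof.
transitivity #|fullv : {vspace finvect_type L}|; first exact/esym/card_vspacef.
exact: card_vspace.
Qed.

Lemma frob_dim (x : L) : frob (\dim {:L}) x = x.
Proof. by rewrite /frob -card_finvect; apply: (@expf_card (finvect_type L)). Qed.

(** The number of roots is strictly below the size of [p], hence below the cardinality of [L]. *)
Lemma exists_nonroot (p : {poly L}) :
  p != 0 -> (size p <= q ^ \dim {:L})%N -> exists x, p.[x] != 0.
Proof.
move=> p_neq0 szp.
have [/existsP //|] := boolP [exists x : finvect_type L, p.[x] != 0].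
rewrite negb_exists => /forallP p0.
have : all (root p) (enum (finvect_type L)).
  by apply/allP=> x _; rewrite rootE -[_ == _]negbK.
move/(max_poly_roots p_neq0)/(_ (enum_uniq _)).
by move=> /leq_trans/(_ szp); rewrite -card_finvect cardE ltnn.
Qed.

(** [X^q - X] is the product of the [X - b] over [b] in [F]. *)
Lemma frob1_fixed (x : L) : frob 1 x = x -> exists a : F, x = a%:A.
Proof.
rewrite /frob expn1 => xq.
pose p := map_poly (in_alg L) ('X^q - 'X).
have : root p x.
  by rewrite /p rmorphB /= map_polyXn map_polyX rootE !hornerE xq subrr.
have -> : p = \prod_(z <- [seq b%:A | b : F]) ('X - z%:P).
  rewrite /p finField_genPoly rmorph_prod big_image /=.
  by apply: eq_bigr => b _; rewrite rmorphB /= map_polyX map_polyC.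
by rewrite root_prod_XsubC => /mapP[a]; exists a.
Qed.

(** The [q ^ \dim E] elements of [E] are roots of [X^(q^i) - X]. *)
Lemma dim_frob_fixed (E : {vspace L}) i : (0 < i)%N ->
  {in E, forall x, frob i x = x} -> (\dim E <= i)%N.
Proof.
move=> i_gt0 fixE.
have q_gt1 : (1 < q)%N := finNzRing_gt1 F.
rewrite -(leq_exp2l _ _ q_gt1) -(@card_vspace F (finvect_type L) _ E) cardE.
pose p : {poly L} := 'X^(q ^ i) - 'X.
have qi_gt1 : (1 < q ^ i)%N by rewrite -[1%N](expn0 q) ltn_exp2l.
have szp : size p = (q ^ i).+1.
  by rewrite size_polyDl size_polyXn // size_polyN size_polyX ltnS.
rewrite -ltnS -szp; apply: (@max_poly_roots L); last exact: enum_uniq.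
  by rewrite -size_poly_gt0 szp.
apply/allP=> x; rewrite (@mem_enum (finvect_type L)) => Ex.
by rewrite rootE !hornerE -/(frob i x) fixE ?subrr.
Qed.

(** The expression is a polynomial in [x] with linear coefficient 1 and degree at most [q ^ 4], too
    small to vanish on all of [L]. *)
Lemma exists_frob_comb (a b : L) : \dim {:L} = 6%N ->
  exists x, x + a * frob 2 x + b * frob 4 x != 0.
Proof.
move=> dimL; pose p : {poly L} := 'X + a *: 'X^(q ^ 2) + b *: 'X^(q ^ 4).
have q_gt1 : (1 < q)%N := finNzRing_gt1 F.
have qi_gt1 i : (0 < i)%N -> (1 < q ^ i)%N.
  by move=> i_gt0; rewrite -[1%N](expn0 q) ltn_exp2l.
have [||x px] := @exists_nonroot p.
- apply/eqP=> /(congr1 (fun p : {poly L} => p`_1)) /eqP.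
  by rewrite !coefE /= !(ltn_eqF (qi_gt1 _ _)) // !mulr0 !addr0 oner_eq0.
- have sz c i : (i < 6)%N -> (size (c *: 'X^(q ^ i) : {poly L})%R <= q ^ 6)%N.
    move=> i6; apply: leq_trans (size_scale_leq _ _) _.
    by rewrite size_polyXn ltn_exp2l.
  rewrite dimL.
  do 2![apply: leq_trans (size_polyD _ _) _; rewrite geq_max sz ?andbT //].
  by rewrite size_polyX qi_gt1.
by exists x; move: px; rewrite !hornerE.
Qed.

Lemma exists_omega : 2 \in [pchar L] -> \dim {:L} = 6%N -> (q %% 3 = 2)%N ->
  exists w : L, w * w = w + 1.
Proof.
move=> L2 dimL q3.
have q_gt0 : (0 < q)%N := ltnW (finNzRing_gt1 F).
have N3 : (3 %| q ^ 6 - 1)%N.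
  by rewrite -eqn_mod_dvd ?expn_gt0 ?q_gt0 // -modnXm q3.
pose N := ((q ^ 6 - 1) %/ 3)%N.
have N3E : (N * 3).+1 = (q ^ 6)%N.
  by rewrite divnK // subn1 prednK // expn_gt0 q_gt0.
(* A nonroot is both nonzero and has [N]-th power different from 1; that power is a primitive cube
   root of unity. *)
pose p : {poly L} := 'X^(N.+1) - 'X.
have N_gt0 : (0 < N)%N.
  rewrite lt0n; apply/eqP=> N0; move/esym/eqP: N3E; rewrite N0.
  by rewrite -[(0 * 3).+1](exp1n 6) eqn_exp2r // gtn_eqF ?finNzRing_gt1.
have szp : size p = N.+2.
  by rewrite size_polyDl size_polyXn // size_polyN size_polyX.
have [||x] := @exists_nonroot p.
- by rewrite -size_poly_gt0 szp.
- by rewrite dimL szp -N3E ltnS ltn_Pmulr.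
rewrite !hornerE subr_eq0 exprS => px.
have x_neq0 : x != 0 by apply: contraNneq px => ->; rewrite mul0r.
have rx : x ^+ N != 1 by apply: contraNneq px => ->; rewrite mulr1.
have r3 : (x ^+ N) ^+ 3 = 1.
  apply: (mulfI x_neq0); rewrite -exprM -exprS N3E mulr1.
  by have := frob_dim x; rewrite dimL.
by exists (x ^+ N); apply: cube_root_unity.
Qed.

End Frobenius.

(** * The subspace [Us] for [q] an odd power of 2: intersections with planes and dimension *)

Section OddPowerOf2.

Variables (h s : nat) (F : finFieldType) (L : fieldExtType F).
Hypotheses (h_odd : odd h) (cardF : #|F| = (2 ^ h)%N) (dimL : \dim {:L} = 6%N)
  (s_range : (1 <= s <= 5)%N) (s_coprime : gcdn s 6 = 1%N).

Let sP : s = 1%N \/ s = 5%N.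
Proof. by case: s s_range s_coprime => [|[|[|[|[|[|]]]]]] //; auto. Qed.

Let L2 : 2 \in [pchar L].
Proof. by rewrite pchar_lalg (card_finPcharP cardF). Qed.

Let frob_mul6 j (x : L) : frob (j * 6) x = x.
Proof.
elim: j => [|j IHj]; first by rewrite /frob expn0 expr1.
by rewrite mulSn addnC -frobD -{2}IHj; congr frob; rewrite -[RHS]frob_dim dimL.
Qed.

Let s6 (x : L) : frob s (frob s (frob s (frob s (frob s (frob s x))))) = x.
Proof.
by rewrite !frobD -[RHS](frob_mul6 s) !mulnS muln0 addn0 !addnA.
Qed.

Let s_pow (x : L) : frob s x = x ^+ (2 ^ (h * s)).
Proof. by rewrite /frob cardF -expnM. Qed.

Let deg_odd : odd (h * s).
Proof. by rewrite oddM h_odd; case: sP => ->. Qed.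

(** For [s = 5] the exponents [2 s = 10] and [4 s = 20] are 4 and 2 modulo 6, so two terms are
    swapped. *)
Lemma Tr62E (x : L) :
  Tr62 x = x + frob s (frob s x) + frob s (frob s (frob s (frob s x))).
Proof.
rewrite !frobD /Tr62 -!/(frob _ _); case: sP => -> //.
rewrite -(frob_mul6 1 (frob 4 x)) -(frob_mul6 3 (frob 2 x)) !frobD.
by rewrite addrAC.
Qed.

Lemma frob_fixed_base (x : L) : frob s x = x -> exists a : F, x = a%:A.
Proof.
move=> xs; apply: frob1_fixed; case: sP xs => -> // xs.
by rewrite -[RHS](frob_mul6 1) -[in LHS]xs frobD.
Qed.

Lemma q_mod3 : (#|F| %% 3 = 2)%N.
Proof.
rewrite cardF -(odd_double_half h) h_odd expnD -mul2n expnM -modnMmr -modnXm.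
by rewrite exp1n.
Qed.

(** Any nonzero Lagrange resolvent is such an eigenvector, and [exists_frob_comb] provides one. *)
Lemma exists_theta (w : L) : w * w = w + 1 ->
  exists2 theta : L, theta != 0 & frob s (frob s theta) = w * theta.
Proof.
move=> w2.
pose r (x : L) := frob s (frob s x).
have [x nz] : exists x, x + (w + 1) * r x + w * r (r x) != 0.
  rewrite /r; case: sP => ->.
    have [x] := exists_frob_comb (w + 1) w dimL.
    by exists x; rewrite !frobD.
  have [x nz] := exists_frob_comb w (w + 1) dimL; exists x.
  move: nz; rewrite -(frob_mul6 1 (frob 4 x)) -(frob_mul6 3 (frob 2 x)) !frobD.
  by rewrite addrAC.
exists (x + (w + 1) * r x + w * r (r x)) => //.
exact: (w_component_eigen L2 w2 deg_odd s_pow s6).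
Qed.

(** Three [F]-independent vectors of [Us] in [W] would be [L]-independent by [relation_trivial],
    against [\dim W = 2]. *)
Lemma Us_cap (W : {vspace 'rV[L]_4}) : \dim W = 2%N ->
  (\dim (Us L s :&: resVspace W) <= 2)%N.
Proof.
move=> dimW; rewrite leqNgt; apply/negP=> dim3.
have [|B [_ /subvP sB dimB]] :=
    vspace_between (sub0v (Us L s :&: resVspace W)) (n := 3).
  by rewrite dimv0.
have sz : size (vbasis B) == 3 by rewrite size_tuple dimB.
pose b := Tuple sz.
have freeb : free b := basis_free (vbasisP B).
have bP (i : 'I_3) : b`_i \in Us L s /\ (b`_i : 'rV[L]_4) \in W.
  have : b`_i \in B by apply: vbasis_mem; rewrite mem_nth // (eqP sz).
  by move/sB; rewrite memv_cap mem_resVspace => /andP.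
suff freebL : free (b : seq 'rV[L]_4).
  have : (<<(b : seq 'rV[L]_4)>> <= W)%VS.
    apply/span_subvP=> v /(nthP 0)[i]; rewrite (eqP sz) => i3 <-.
    exact: (bP (Ordinal i3)).2.
  by move/dimvS; rewrite (eqP freebL) dimW (eqP sz).
pose x : 'rV[L]_3 := \row_i (b`_i : 'rV[L]_4) 0 0.
pose y : 'rV[L]_3 := \row_i (b`_i : 'rV[L]_4) 0 1.
have bE i : [/\ Tr62 (x 0 i) = 0, Tr62 (y 0 i) = 0 & b`_i = Uvec s (x 0 i) (y 0 i)].
  have /mem_Us[x1 [y1 [Tx Ty e]]] := (bP i).1.
  by rewrite !mxE e !mxE.
have [w w2] := exists_omega L2 dimL q_mod3.
have [theta th_neq0 ssth] := exists_theta w2.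
apply/freeP=> k k0 i; pose lam : 'rV[L]_3 := \row_i k i.
suff /rowP/(_ i) : lam = 0 by rewrite !mxE.
have kE (j : 'I_4) : \sum_i k i * (b`_i : 'rV[L]_4) 0 j = 0.
  move/rowP/(_ j): k0; rewrite summxE mxE => k0.
  by rewrite -[RHS]k0; apply: eq_bigr => i' _; rewrite mxE.
have trK (z : 'rV[L]_3) : (forall i, Tr62 (z 0 i) = 0) ->
    z + map_mx (frob s) (map_mx (frob s) z)
      + map_mx (frob s) (map_mx (frob s) (map_mx (frob s) (map_mx (frob s) z))) = 0.
  by move=> Tz; apply/rowP=> j; rewrite !mxE -(Tz j) Tr62E.
apply: (relation_trivial L2 w2 deg_odd s_pow s6 th_neq0 ssth (x := x) (y := y)).
- by apply: trK => j; case: (bE j).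
- by apply: trK => j; case: (bE j).
(* A vector fixed by [frob s] has entries in [F], and [Uvec2] carries an [F]-relation between the
   pairs [(x_j, y_j)] to one between the [b_j]. *)
- move=> g gs gx gy.
  have gF j : exists a : F, g 0 j = a%:A.
    by apply: frob_fixed_base; rewrite -{2}gs mxE.
  have [c cE] := fin_all_exists gF.
  have c0 : forall j, c j = 0.
    move/freeP: freeb; apply.
    pose z j := (x 0 j, y 0 j).
    transitivity (Uvec2 s (\sum_j c j *: z j)).
      rewrite linear_sum; apply: eq_bigr => j _; rewrite linearZ /=.
      by congr (_ *: _); case: (bE j).
    have -> : \sum_j c j *: z j = 0.
      apply: injective_projections.
        rewrite (raddf_sum fst) /= -[RHS]gx; apply: eq_bigr => j _.
        by rewrite cE mulr_algl.
      rewrite (raddf_sum snd) /= -[RHS]gy; apply: eq_bigr => j _.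
      by rewrite cE mulr_algl.
    exact: linear0.
  by apply/rowP=> j; rewrite cE c0 scale0r mxE.
- by rewrite -[RHS](kE 0); apply: eq_bigr => j _; rewrite !mxE.
- by rewrite -[RHS](kE 1); apply: eq_bigr => j _; rewrite !mxE.
- rewrite -[RHS](kE 2); apply: eq_bigr => j _; have [_ _ ->] := bE j.
  by rewrite !mxE.
- rewrite -[RHS](kE 3); apply: eq_bigr => j _; have [_ _ ->] := bE j.
  by rewrite !mxE.
Qed.

Lemma frob2_Tr62 (x : L) : frob 2 (Tr62 x) = Tr62 x.
Proof.
rewrite /Tr62 -!/(frob _ _) !rmorphD /= !frobD.
by rewrite (frob_mul6 1 x : frob (2 + 4) x = x) addrC addrA.
Qed.

(** Each trace has its image in the fixed field of [frob 2], of dimension at most 2, so the two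
    conditions leave at least [12 - 2 - 2]. *)
Lemma dim_Us : (8 <= \dim (Us L s))%N.
Proof.
have inj : lker (linfun (@Uvec2 F L s)) == 0%VS.
  apply/lker0P=> -[x1 y1] [x2 y2]; rewrite !lfunE /= => e.
  move/rowP: (e : Uvec _ _ _ = Uvec _ _ _) => e'.
  by move: (e' 0) (e' 1); rewrite !mxE /= => -> ->.
rewrite limg_dim_eq ?(eqP inj) ?capv0 //.
have img2 (f : {linear (L * L)%type -> L}) U : (forall z, frob 2 (f z) = f z) ->
    (\dim (linfun f @: U) <= 2)%N.
  move=> fixf; apply: (@dim_frob_fixed F L) => // _ /memv_imgP[z _ ->].
  by rewrite lfunE fixf.
have dimLL : \dim {:(L * L)%type} = 12%N.
  by move: dimL; rewrite !dimvf => dL; rewrite [LHS]/(dim L + dim L)%N dL.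
pose f1 := linfun (@Tr62 F L \o (@fst L L)).
pose f2 := linfun (@Tr62 F L \o (@snd L L)).
have le1 : (\dim (f1 @: fullv) <= 2)%N by apply: img2 => z; apply: frob2_Tr62.
have le2 : (\dim (f2 @: lker f1) <= 2)%N by apply: img2 => z; apply: frob2_Tr62.
have := limg_ker_dim f2 (lker f1); have := limg_ker_dim f1 fullv.
rewrite capfv dimLL => e1 e2.
rewrite -(leq_add2r 2) (leq_trans _ (leq_add (leqnn _) le2)) // e2.
by rewrite -(leq_add2r 2) (leq_trans _ (leq_add (leqnn _) le1)) // e1.
Qed.

End OddPowerOf2.

(* Scatteredness and maximality from the dimension bound *)
Local Close Scope ring_scope.

Theorem mainTheorem1 (h s : nat) (F : finFieldType) (L : fieldExtType F)
    (h_ge1 : (1 <= h)%N) (h_odd : odd h)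
    (cardF : #|F| = (2 ^ h)%N) (dimL : \dim {:L}%VS = 6)
    (s_range : (1 <= s <= 5)%N) (s_coprime : gcdn s 6 = 1%N) :
  max_scattered 2 (Us L s).
Proof.
have dim4 : \dim {:'rV[L]_4} = 4 by rewrite dimvf /dim /= mul1n.
have capU := Us_cap h_odd cardF dimL s_range s_coprime.
have dimU : (8 <= \dim (Us L s))%N := dim_Us s dimL.
(* The bound [3 \dim U <= 6 \dim (lspan U)], divided by 3. *)
have bound (U : {vspace resScal 'rV[L]_4}) :
    (forall W : {vspace 'rV[L]_4}, \dim W = 2%N ->
      (\dim (U :&: resVspace W) <= 2)%N) ->
    (3 <= \dim U)%N -> (\dim U <= 2 * \dim (lspan U))%N.
  move=> cap U3; have := scattered_dim_bound cap.
  rewrite dim4 dimL => /(_ isT U3 isT).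
  by rewrite mulnC -[6]/(2 * 3)%N mulnA leq_pmul2r // mulnC.
split.
  split; rewrite ?dim4 //; apply/eqP; rewrite eqEdim subvf dim4.
  (* [8 <= 2 \dim (lspan U)] forces the span to have dimension 4. *)
  have := leq_trans dimU (bound _ capU (leq_trans (isT : 2 < 8) dimU)).
  by rewrite -[8]/(2 * 4)%N leq_pmul2l.
(* A larger [U'] would have dimension at least 9, above the bound [2 * 4]. *)
move=> U' [_ _ cap']; apply: leq_trans dimU; rewrite leqNgt; apply/negP=> dimU'.
have := leq_trans dimU' (bound _ cap' (leq_trans (isT : 2 < 9) dimU')).
have := dimvS (subvf (lspan U')); rewrite dim4 -(leq_pmul2l (isT : 0 < 2)%N).
by move=> le8 /leq_trans/(_ le8).
Qed.
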